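(* Let $\alpha$ be a dotted composition and let $S$ be the antipode of ${\rm sQSym}$. Then $$S(M_\alpha)=(-1)^{\ell(\alpha)+\binom{m_\alpha}{2}}\sum_{\gamma\,\trianglerighteq\,\operatorname{rev}(\alpha)}M_\gamma,$$ where $m_\alpha$ is the fermionic degree of $\alpha$ and $\operatorname{rev}(\alpha)$ is the reverse of $\alpha$.
   Context: Variables $x_1,x_2,\dots$ commute; $\theta_1,\theta_2,\dots$ anticommute ($\theta_i\theta_j=-\theta_j\theta_i$, $\theta_i^2=0$). A dotted composition $\alpha=(\alpha_1,\dots,\alpha_l)$ is a finite (possibly empty) sequence whose entries belong to $\{1,2,3,\dots\}$ (non-dotted) or $\{\dot0,\dot1,\dot2,\dots\}$ (dotted). Its length is $\ell(\alpha)=l$, its fermionic degree $m_\alpha$ is its number of dotted parts, and $\operatorname{rev}(\alpha)=(\alpha_l,\dots,\alpha_1)$. Put $\eta_i=1$ if $\alpha_i$ is dotted and $\eta_i=0$ otherwise. ${\rm sQSym}$ is the $\mathbb Q$-algebra of bounded-degree formal power series $f$ in these variables such that, for every dotted composition $\alpha$, all monomials $\theta_{i_1}^{\eta_1}\cdots\theta_{i_l}^{\eta_l}x_{i_1}^{\alpha_1}\cdots x_{i_l}^{\alpha_l}$ with $i_1<\cdots<i_l$ have the same coefficient in $f$ (dots ignored in exponents). It has the basis $M_\alpha=\sum_{i_1<\cdots<i_l}\theta_{i_1}^{\eta_1}\cdots\theta_{i_l}^{\eta_l}x_{i_1}^{\alpha_1}\cdots x_{i_l}^{\alpha_l}$,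 with $M_\emptyset=1$. The partial order $\trianglelefteq$ on dotted compositions is the reflexive and transitive closure of the covering relation: $\beta\trianglelefteq\alpha$ if $\alpha$ is obtained from $\beta$ by adding together two adjacent parts of $\beta$ that are not both dotted; the sum of a dotted part and a non-dotted part is dotted. $\gamma\trianglerighteq\beta$ means $\beta\trianglelefteq\gamma$. Hopf structure: ${\rm sQSym}\otimes{\rm sQSym}$ is identified with functions, quasisymmetric in each set, of two sets of variables $(x;\theta)$, $(y;\phi)$, ordered by $x_1<x_2<\cdots<y_1<y_2<\cdots$ and $\theta_1<\theta_2<\cdots<\phi_1<\phi_2<\cdots$, with the $\theta$'s and $\phi$'s anticommuting; $f\otimes g$ corresponds to $f(x;\theta)g(y;\phi)$. The coproduct is $(\Delta f)(x,y;\theta,\phi)=f(x,y;\theta,\phi)$, i.e. $f$ evaluated on the ordered union of the two sets of variables. The counit $\epsilon$ sends $1$ to $1$ and $M_\alpha$ to $0$ for $\alpha\ne\emptyset$. The antipode $S$ is the unique linear map with $\mathrm{mult}\circ(S\otimes1)\circ\Delta=u\circ\epsilon=\mathrm{mult}\circ(1\otimes S)\circ\Delta$ ($\mathrm{mult}$ the multiplication, $u$ the unit map). *)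

(* Defs.v *)
From HB Require Import structures.
From mathcomp Require Import all_boot all_order all_algebra finmap.
From mathcomp Require Import boolp classical_sets functions cardinality fsbigop.
From Stdlib Require Import Relation_Operators.

Set Implicit Arguments.
Unset Strict Implicit.
Unset Printing Implicit Defensive.

Import Order.TTheory GRing.Theory.
Local Open Scope classical_set_scope.
Local Open Scope fset_scope.
Local Open Scope ring_scope.

(** * Dotted compositions *)

(* [(d, a)] is the part [a], dotted iff [d]; only a dotted part may be [0]. *)
Definition dpart := {p : bool * nat | p.1 || (0 < p.2)%N}.

HB.instance Definition _ := Countable.on dpart.

Definition dotted (p : dpart) : bool := (val p).1.
Definition weight (p : dpart) : nat := (val p).2.

Lemma dpart_add_subproof (p q : dpart) :
  (dotted p || dotted q) || (0 < weight p + weight q)%N.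
Proof.
case: p q => [[[] a] /= pa] [[[] b] /= qb] //=.
by rewrite /dotted /weight /= addn_gt0 pa.
Qed.

Definition dpart_add (p q : dpart) : dpart :=
  exist _ (dotted p || dotted q, weight p + weight q)%N
    (dpart_add_subproof p q).

Definition dcomp := seq dpart.

HB.instance Definition _ := Countable.on dcomp.

Definition fdeg (alpha : dcomp) : nat := count dotted alpha.

(* [dcover beta alpha]: [alpha] is obtained from [beta] by one addition. *)
Inductive dcover : dcomp -> dcomp -> Prop :=
  DCover (s t : dcomp) (p q : dpart) of ~~ (dotted p && dotted q) :
    dcover (s ++ [:: p, q & t]) (s ++ dpart_add p q :: t).

(* [dle beta alpha] is the order relation "beta is below alpha"; the elements above
   a given one form a finite set by [finite_dle]. *)
Definition dle : dcomp -> dcomp -> Prop := clos_refl_trans dcomp dcover.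

(** * Formal power series in commuting [x_i] and anticommuting [theta_i]

    The indices [i] range over a totally ordered type [A]: [nat] for one set of
    variables (numbered from 0), and [bool *l nat] for the ordered union of two
    of them. *)

(* [m i = (d, a)] means that [m] contains the factors [theta_i ^ d] and
   [x_i ^ a]. The thetas of a monomial are multiplied in increasing order of
   their indices. *)
Definition monomial d (A : orderType d) :=
  {fsfun A -> (bool * nat)%type with (false, 0%N)}.

Definition series d (A : orderType d) := monomial A -> rat^o.

HB.instance Definition _ d (A : orderType d) := Choice.on (monomial A).
HB.instance Definition _ d (A : orderType d) := GRing.Lmodule.on (series A).

(* The number of variables of [m], counted with multiplicity. *)
Definition mdeg d (A : orderType d) (m : monomial A) : nat :=
  (\sum_(i <- finsupp m) ((m i).1 + (m i).2))%N.

(* [mtype m] is the sequence [alpha] such that [m] is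
   theta_(i_1)^(eta_1) .. theta_(i_l)^(eta_l) x_(i_1)^(alpha_1) ..
   x_(i_l)^(alpha_l) for some i_1 < .. < i_l. *)
Definition mtype d (A : orderType d) (m : monomial A) : seq (bool * nat) :=
  [seq m i | i <- sort <=%O (finsupp m)].

Definition mmul d (A : orderType d) (m n : monomial A) : monomial A :=
  [fsfun i in finsupp m `|` finsupp n =>
    ((m i).1 || (n i).1, ((m i).2 + (n i).2)%N)].

(* Otherwise [m * n = 0], since theta_i ^ 2 = 0. *)
Definition mcompat d (A : orderType d) (m n : monomial A) : Prop :=
  forall i, ~~ ((m i).1 && (n i).1).

(* The number of transpositions of thetas needed to sort [m * n]. *)
Definition minv d (A : orderType d) (m n : monomial A) : nat :=
  (\sum_(i <- finsupp m) \sum_(j <- finsupp n)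
    [&& (m i).1, (n j).1 & (j < i)%O])%N.

(* The sum is finite, see [finite_splits]. *)
Definition smul d (A : orderType d) (f g : series A) : series A := fun m =>
  \sum_(p \in [set p : monomial A * monomial A |
                 mcompat p.1 p.2 /\ mmul p.1 p.2 = m])
    ((-1) ^+ minv p.1 p.2 * f p.1 * g p.2 : rat).

Definition sone d (A : orderType d) : series A := fun m => (m == [fsfun])%:R.

Arguments sone {d} A.

(** * The space sQSym *)

Definition bounded_degree (f : series nat) : Prop :=
  exists N : nat, forall m, f m != 0 -> (mdeg m <= N)%N.

Definition quasisym (f : series nat) : Prop :=
  forall m n : monomial nat, mtype m = mtype n -> f m = f n.

Definition is_sQSym (f : series nat) : bool :=
  `[< bounded_degree f /\ quasisym f >].

Lemma is_sQSym_submod_closed : submod_closed is_sQSym.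
Proof.
split.
  by apply/asboolP; split=> [|//]; exists 0%N => m; rewrite eqxx.
move=> a f g /asboolP[[N1 f1] fq] /asboolP[[N2 g2] gq].
apply/asboolP; split; last by move=> m n e; rewrite !fctE (fq _ _ e) (gq _ _ e).
exists (maxn N1 N2) => m; rewrite !fctE leq_max.
have [-> gm|/f1 -> //] := eqVneq (f m) 0.
by rewrite g2 ?orbT //; apply: contraNneq gm => ->; rewrite scaler0 addr0.
Qed.

HB.instance Definition _ :=
  GRing.isSubmodClosed.Build rat (series nat) is_sQSym is_sQSym_submod_closed.

Record sQSym := SQSym { sqval :> series nat; _ : sqval \in is_sQSym }.

HB.instance Definition _ := [isSub for sqval].
HB.instance Definition _ := [Choice of sQSym by <:].
HB.instance Definition _ := [SubChoice_isSubLmodule of sQSym by <:].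

(* The monomial basis, over an arbitrary ordered set of variables. *)
Definition Mseries d (A : orderType d) (alpha : dcomp) : series A :=
  fun m => (mtype m == map val alpha)%:R.

Lemma mdeg_mtype d (A : orderType d) (m : monomial A) :
  mdeg m = (\sum_(p <- mtype m) (p.1 + p.2))%N.
Proof.
rewrite /mdeg /mtype big_map; apply: perm_big.
by rewrite perm_sym perm_sort.
Qed.

Lemma Mseries_is_sQSym alpha : Mseries alpha \in is_sQSym.
Proof.
apply/asboolP; split; last by move=> m n; rewrite /Mseries => ->.
exists (\sum_(p <- map val alpha) (p.1 + p.2))%N => m.
by rewrite mdeg_mtype /Mseries; have [->|] := eqVneq (mtype m); rewrite ?eqxx.
Qed.

Definition M (alpha : dcomp) : sQSym := SQSym (Mseries_is_sQSym alpha).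

(** * The Hopf structure *)

(* The monomial on the first indices with type [s]. *)
Definition std (s : seq (bool * nat)) : monomial nat :=
  [fsfun i in [fset i | i in iota 0 (size s)] => nth (false, 0%N) s i].

(* A quasisymmetric function can be evaluated on any ordered set [A] of
   variables: the coefficient of a monomial depends on its type only. *)
Definition eval d (A : orderType d) (f : sQSym) : series A :=
  fun m => sqval f (std (mtype m)).

(* [(false, i)] indexes x_i and theta_i, and [(true, i)] indexes y_i and phi_i;
   the lexicographic order puts the former before the latter. *)
Definition alphabet2 := (bool *l nat)%type.

Definition coproduct (f : sQSym) : series alphabet2 := eval f.

(* The factor of [m] in the variables (x; theta) if [b = false], and in the
   variables (y; phi) if [b = true]. *)
Definition mfactor (b : bool) (m : monomial alphabet2) : monomial nat :=
  [fsfun i in [fset k.2 | k in finsupp m] => m ((b, i) : alphabet2)].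

(* f(x; theta) g(y; phi): no sign arises because each theta precedes each phi,
   both in the product and in the alphabet. *)
Definition tens (f g : sQSym) : series alphabet2 :=
  fun m => sqval f (mfactor false m) * sqval g (mfactor true m).

(* The constant term, see [counit_M]. *)
Definition counit (f : sQSym) : rat := sqval f [fsfun].

(* The linear maps [S (x) 1] and [1 (x) S] are evaluated on a decomposition of
   the coproduct into pure tensors; the value does not depend on the
   decomposition since [tens] identifies the tensor square of sQSym with a
   space of series. [coproduct_M] gives a decomposition for the basis. *)
Definition is_antipode (S : {linear sQSym -> sQSym}) : Prop :=
  forall (f : sQSym) (n : nat) (g h : 'I_n -> sQSym),
    coproduct f = \sum_(i < n) tens (g i) (h i) ->
    \sum_(i < n) smul (S (g i)) (h i) = counit f *: sone nat /\
    \sum_(i < n) smul (g i) (S (h i)) = counit f *: sone nat.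

(** * Consistency of the definitions *)

Lemma finite_splits d (A : orderType d) (m : monomial A) :
  finite_set [set p : monomial A * monomial A |
                mcompat p.1 p.2 /\ mmul p.1 p.2 = m].
Proof.
pose N := (\sum_(i <- finsupp m) (m i).2)%N.
pose B := (bool * 'I_N.+1)%type.
pose out (b : B) : bool * nat := (b.1, val b.2).
pose g (h : {ffun finsupp m -> B * B}) : monomial A * monomial A :=
  ([fsfun i : finsupp m => out (h i).1], [fsfun i : finsupp m => out (h i).2]).
apply: (@sub_finite_set _ _ (g @` setT)); last exact/finite_image/finite_finset.
move=> [a b] /= [_ abm].
have mE i : m i = ((a i).1 || (b i).1, ((a i).2 + (b i).2)%N).
  rewrite -abm fsfunE in_fsetU.
  case: (finsuppP a i) => [/negbTE ia|ia] //=.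
  by case: (finsuppP b i).
have le2 i : ((m i).2 <= N)%N.
  case: (finsuppP m i) => [//|im].
  by rewrite /N (big_rem _ im) leq_addr.
have a0 i : i \notin finsupp m -> a i = (false, 0%N).
  rewrite memNfinsupp mE => /eqP[]; case: (a i) (b i) => [[] n] [[] k] //= _.
  by case: n.
have b0 i : i \notin finsupp m -> b i = (false, 0%N).
  rewrite memNfinsupp mE => /eqP[]; case: (a i) (b i) => [[] n] [[] k] //= _.
  by case: n => //; case: k.
pose inn (x : bool * nat) : B := (x.1, inord x.2).
have innK x : (x.2 <= N)%N -> out (inn x) = x.
  by case: x => x1 x2 xN; rewrite /out /= inordK.
exists [ffun i => (inn (a (val i)), inn (b (val i)))]; first by [].
congr pair; apply/fsfunP => i; rewrite fsfun_ffun; case: insubP => [u iu <-|iu].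
- rewrite /= ffunE /= innK //; apply: leq_trans (le2 (val u)).
  by rewrite mE leq_addr.
- by rewrite a0.
- rewrite /= ffunE /= innK //; apply: leq_trans (le2 (val u)).
  by rewrite mE leq_addl.
- by rewrite b0.
Qed.

Lemma finite_dle (beta : dcomp) :
  finite_set [set gamma | dle beta gamma].
Proof.
pose W (b : dcomp) := (\sum_(p <- b) weight p)%N.
have inv b c : dle b c -> (size c <= size b)%N /\ W c = W b.
  elim=> {b c} [_ _ [s t p q _]|//|b c e _ [bc <-] _ [ce <-]].
    split; first by rewrite !size_cat /= !addnS.
    by rewrite /W !big_cat !big_cons /= -[weight (dpart_add p q)]/(_ + _)%N -addnA.
  by split=> //; apply: leq_trans ce bc.
pose T := (bool * 'I_(W beta).+1)%type.
pose g (x : (size beta).-bseq T) : dcomp :=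
  [seq insubd (exist _ (true, 0%N) isT : dpart) (y.1, val y.2) | y <- x].
apply: (@sub_finite_set _ _ (g @` setT)); last exact/finite_image/finite_finset.
move=> c /inv [cb cW].
pose x : seq T := [seq (dotted p, inord (weight p)) | p <- c].
have sx : (size x <= size beta)%N by rewrite size_map.
exists (Bseq sx) => //; rewrite /g /= -map_comp -[RHS]map_id.
apply/eq_in_map => p pc; apply: val_inj; rewrite /= inordK.
  rewrite insubdK //; first by case: p {pc} => [[]].
  by rewrite -topredE /=; case: p {pc} => [[]].
by rewrite ltnS -cW /W (big_rem _ pc) leq_addr.
Qed.

Lemma mtype_std (s : seq (bool * nat)) :
  (false, 0%N) \notin s -> mtype (std s) = s.
Proof.
move=> s0; rewrite /mtype.
have sE i : i \in iota 0 (size s) -> std s i = nth (false, 0%N) s i.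
  by move=> i_s; rewrite fsfunE inE i_s.
have -> : sort <=%O (finsupp (std s)) = iota 0 (size s).
  apply: le_sorted_eq; [exact: sort_le_sorted|exact: iota_sorted|].
  rewrite perm_sort; apply: uniq_perm; rewrite ?fset_uniq ?iota_uniq // => i.
  rewrite mem_finsupp; have [/[dup] i_s|i_s] := boolP (i \in iota 0 (size s)).
    move/sE ->; apply: contraNneq s0 => <-; apply: mem_nth.
    by rewrite mem_iota in i_s.
  by rewrite fsfunE inE /= (negbTE i_s) eqxx.
rewrite -[RHS]take_size -(map_nth_iota0 (false, 0%N)) //.
exact/eq_in_map.
Qed.

Lemma mtype_neq0 d (A : orderType d) (m : monomial A) :
  (false, 0%N) \notin mtype m.
Proof.
apply/mapP => -[i]; rewrite mem_sort mem_finsupp => mi0 mi.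
by rewrite -mi eqxx in mi0.
Qed.

Lemma eval_nat (f : sQSym) : eval f = f :> series nat.
Proof.
apply/funext => m; case: f => f fP; rewrite /eval /=.
have /asboolP[_ fq] := fP.
by apply: fq; rewrite mtype_std ?mtype_neq0.
Qed.

Lemma eval_M d (A : orderType d) (alpha : dcomp) :
  eval (M alpha) = Mseries alpha :> series A.
Proof. by apply/funext => m; rewrite /eval /= /Mseries mtype_std ?mtype_neq0. Qed.

Lemma counit_M (alpha : dcomp) : counit (M alpha) = (alpha == [::])%:R.
Proof. by rewrite /counit /= /Mseries /mtype finsupp0 /=; case: alpha. Qed.

Lemma mfactorE b (m : monomial alphabet2) i : mfactor b m i = m (b, i).
Proof.
rewrite fsfunE; case: ifPn => // /imfsetP h.
case: (finsuppP m (b, i)) => // bi.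
by case: h; exists (b, i).
Qed.

Lemma mtype_mfactor (m : monomial alphabet2) :
  mtype m = mtype (mfactor false m) ++ mtype (mfactor true m).
Proof.
pose e b := [seq ((b, i) : alphabet2) | i <- sort <=%O (finsupp (mfactor b m))].
have eE b c i : ((c, i) \in e b) = (c == b) && ((b, i) \in finsupp m).
  apply/mapP/andP => [[j + [-> ->]]|[/eqP -> bi]].
    by rewrite mem_sort mem_finsupp mfactorE -mem_finsupp.
  by exists i; rewrite // mem_sort mem_finsupp mfactorE -mem_finsupp.
have -> : mtype m = [seq m i | i <- e false ++ e true].
  congr map; apply: le_sorted_eq; first exact: sort_le_sorted.
    have se b : pairwise <=%O (e b).
      have := sort_le_sorted (finsupp (mfactor b m)).
      rewrite le_sorted_pairwise pairwise_map; apply: sub_pairwise => i j ij.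
      by case: b => //=; rewrite ij.
    rewrite le_sorted_pairwise pairwise_cat !se !andbT.
    by apply/allrelP => -[c i] [c' j]; rewrite !eE => /andP[/eqP -> _] /andP[/eqP ->].
  rewrite perm_sort; apply: uniq_perm; rewrite ?fset_uniq // ?cat_uniq.
    rewrite !map_inj_uniq ?sort_uniq ?fset_uniq //=; try by move=> i j [].
    by rewrite andbT; apply/hasPn => -[c i]; rewrite !eE => /andP[/eqP ->].
  by move=> [[] i]; rewrite mem_cat !eE /= ?orbF.
by rewrite map_cat -!map_comp; congr (_ ++ _); apply/eq_map => i /=; rewrite mfactorE.
Qed.

Lemma coproduct_M (alpha : dcomp) :
  coproduct (M alpha) =
    \sum_(k < (size alpha).+1) tens (M (take k alpha)) (M (drop k alpha)).
Proof.
rewrite /coproduct eval_M; apply/funext => m.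
rewrite fct_sumE /Mseries mtype_mfactor.
set s := mtype (mfactor false m); set t := mtype (mfactor true m).
have tE k : tens (M (take k alpha)) (M (drop k alpha)) m =
    ((s == take k (map val alpha)) && (t == drop k (map val alpha)))%:R.
  by rewrite /tens /= /Mseries -/s -/t map_take map_drop -natrM mulnb.
under eq_bigr do rewrite tE.
rewrite -(size_map val); set a := map val alpha.
have [st|st] := eqVneq (s ++ t) a.
  have ks : (size s < (size a).+1)%N by rewrite -st size_cat ltnS leq_addr.
  have tk : take (size s) a = s by rewrite -st take_size_cat.
  have dk : drop (size s) a = t by rewrite -st drop_size_cat.
  rewrite (bigD1 (Ordinal ks)) //= tk dk !eqxx big1 ?addr0 // => k.
  rewrite -val_eqE /=; case: (s =P _) => //= ->.
  by rewrite size_takel ?eqxx // -ltnS.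
rewrite big1 // => k _; case: andP => // -[/eqP sk /eqP tk].
by rewrite sk tk cat_take_drop eqxx in st.
Qed.

(* Main.v *)
Require Import Defs.
From mathcomp Require Import all_boot all_order all_algebra finmap.
From mathcomp Require Import boolp classical_sets functions cardinality fsbigop.
From Stdlib Require Import Relation_Operators.

Set Implicit Arguments.
Unset Strict Implicit.
Unset Printing Implicit Defensive.

Import Order.TTheory GRing.Theory.
Local Open Scope classical_set_scope.
Local Open Scope fset_scope.
Local Open Scope ring_scope.

(** Let w(i) be the product over k of the letters theta_(i_k)^(eta_k)
    x_(i_k)^(alpha_k), for a sequence of indices i. Then M_alpha is the sum of
    w(i) over the strictly increasing i. Reversing the order of the thetas,
    (-1)^binom(m,2) times the sum of the M_gamma over gamma above rev(alpha) is
    the sum of w(i) over the weakly decreasing i: equal indices correspond to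
    merged parts, and theta^2 = 0 forbids the merging of two dotted parts.
    Hence, in the convolution of the claimed antipode with the identity, w(i)
    has the coefficient sum_k (-1)^k, where k ranges over the positions such
    that i_1 >= .. >= i_k and i_(k+1) < .. < i_l. This vanishes for l > 0, as
    the only two such k are consecutive or there is no such k. *)

(** Used where at most one summand survives: a sum of indicators then becomes a 0/1 coefficient of a
    monomial series. *)
Lemma sum_unique (T : eqType) (s : seq T) (P : pred T) : uniq s ->
    {in s &, forall x y, P x -> P y -> x = y} ->
  \sum_(x <- s) (P x)%:R = (has P s)%:R :> rat.
Proof.
move=> us Pinj; case: hasP => [[x xs Px]|nP].
  rewrite (bigD1_seq x) //= Px big_seq_cond big1 ?addr0 // => y /andP[ys].
  by have [/(Pinj _ _ ys xs) -> //|] := boolP (P y); rewrite ?eqxx.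
rewrite big_seq big1 // => y ys; have [Py|//] := boolP (P y).
by case: nP; exists y.
Qed.

(** * Products of monomials and their signs *)

Section Monomials.
Context {d} {A : orderType d}.
Implicit Types (m n p : monomial A) (i : A).

Lemma mmulE m n i : mmul m n i = ((m i).1 || (n i).1, (m i).2 + (n i).2)%N.
Proof.
rewrite fsfunE in_fsetU.
case: (finsuppP m i) => [|] //= _.
by case: (finsuppP n i).
Qed.

Lemma mmulA : associative (@mmul d A).
Proof. by move=> m n p; apply/fsfunP => i; rewrite !mmulE /= orbA addnA. Qed.

Lemma mmulC : commutative (@mmul d A).
Proof. by move=> m n; apply/fsfunP => i; rewrite !mmulE orbC addnC. Qed.

Lemma mmul0m : left_id [fsfun] (@mmul d A).
Proof. by move=> m; apply/fsfunP => i; rewrite mmulE fsfun0E /=; case: (m i). Qed.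

Lemma mmulm0 : right_id [fsfun] (@mmul d A).
Proof. by move=> m; rewrite mmulC mmul0m. Qed.

Lemma mcompatC m n : mcompat m n -> mcompat n m.
Proof. by move=> mn i; rewrite andbC. Qed.

Lemma mcompat0m m : mcompat [fsfun] m.
Proof. by move=> i; rewrite fsfun0E. Qed.

Lemma mcompatMl m n p : mcompat (mmul m n) p <-> mcompat m p /\ mcompat n p.
Proof.
split=> [h|[hm hn] i]; last first.
  by have := hm i; have := hn i; rewrite mmulE /=; do 3 case: (_.1).
by split=> i; have := h i; rewrite mmulE /=; do 3 case: (_.1).
Qed.

Lemma finsupp_mmul m n : finsupp (mmul m n) = finsupp m `|` finsupp n.
Proof.
apply/fsetP => i; rewrite in_fsetU !mem_finsupp mmulE.
by case: (m i) (n i) => [[] [|a]] [[] [|b]].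
Qed.

(** Indices outside the supports carry no theta. A common index set allows inversion counts of
    different pairs to be compared term by term. *)
Lemma minv_widen (X : {fset A}) m n :
    finsupp m `<=` X -> finsupp n `<=` X ->
  minv m n = (\sum_(i <- X) \sum_(j <- X) [&& (m i).1, (n j).1 & (j < i)%O])%N.
Proof.
move=> mX nX; rewrite /minv (big_fset_incl _ mX) => [|i _]; last first.
  by rewrite memNfinsupp => /eqP ->; rewrite big1.
apply: eq_bigr => i _; apply: big_fset_incl nX _ => j _.
by rewrite memNfinsupp => /eqP ->; rewrite andbF.
Qed.

(** By compatibility each theta occurs in at most one of [m] and [n], so the theta indicator of
    [mmul m n] is the sum of theirs. *)
Lemma minvMl m n p :
  mcompat m n -> minv (mmul m n) p = (minv m p + minv n p)%N.
Proof.
move=> mn; pose X := finsupp m `|` finsupp n `|` finsupp p.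
have mX : finsupp m `<=` X by rewrite /X -fsetUA fsubsetUl.
have nX : finsupp n `<=` X by rewrite /X fsetUAC fsubsetUr.
have pX : finsupp p `<=` X by rewrite fsubsetUr.
have mnX : finsupp (mmul m n) `<=` X by rewrite finsupp_mmul fsubsetUl.
rewrite !(@minv_widen X) // -big_split; apply: eq_bigr => i _.
rewrite -big_split; apply: eq_bigr => j _; rewrite mmulE /=.
by have := mn i; do 3 case: (_.1) => //=; rewrite ?addn0.
Qed.

Lemma minvMr m n p :
  mcompat n p -> minv m (mmul n p) = (minv m n + minv m p)%N.
Proof.
move=> np; pose X := finsupp m `|` finsupp n `|` finsupp p.
have mX : finsupp m `<=` X by rewrite /X -fsetUA fsubsetUl.
have nX : finsupp n `<=` X by rewrite /X fsetUAC fsubsetUr.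
have pX : finsupp p `<=` X by rewrite fsubsetUr.
have npX : finsupp (mmul n p) `<=` X by rewrite finsupp_mmul /X -fsetUA fsubsetUr.
rewrite !(@minv_widen X) // -big_split; apply: eq_bigr => i _.
rewrite -big_split; apply: eq_bigr => j _; rewrite mmulE /=.
by have := np j; do 3 case: (_.1) => //=; rewrite ?addn0.
Qed.

Lemma minv0m m : minv [fsfun] m = 0%N.
Proof. by rewrite /minv finsupp0 big_seq_fset0. Qed.

Lemma minvm0 m : minv m [fsfun] = 0%N.
Proof. by rewrite /minv finsupp0 big1 // => i _; rewrite big_seq_fset0. Qed.

Lemma smulr1 (f : series A) : smul f (sone A) = f.
Proof.
apply/funext => m; rewrite /smul.
rewrite -(@fsbig_widen _ _ _ _ [set (m, [fsfun])]) /=.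
- by rewrite fsbig_set1 /= minvm0 /sone eqxx !mul1r mulr1.
- by move=> _ ->; split; [exact/mcompatC/mcompat0m|exact: mmulm0].
- move=> -[p q] [] [] /= _ pq ne; rewrite /sone; case: eqP => [q0|]; last first.
    by rewrite mulr0.
  by case: ne; rewrite -pq q0 mmulm0.
Qed.

(** * Words in the letters [theta_i^d x_i^a] *)

Definition letter := (A * (bool * nat))%type.
Implicit Types (x y : letter) (u v : seq letter).

Definition lmon x : monomial A := [fsfun [fsfun] with x.1 |-> x.2].

Lemma lmonE x i : lmon x i = if i == x.1 then x.2 else (false, 0%N).
Proof. by rewrite fsfun_withE fsfun0E. Qed.

Lemma mcompat_lmon x m : mcompat (lmon x) m <-> ~~ (x.2.1 && (m x.1).1).
Proof.
split=> [/(_ x.1)|h i]; rewrite lmonE ?eqxx //.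
by case: eqP => [->|].
Qed.

Lemma finsupp_lmon x : finsupp (lmon x) `<=` [fset x.1].
Proof.
apply/fsubsetP => i; rewrite mem_finsupp lmonE inE.
by case: ifP => //; rewrite eqxx.
Qed.

Lemma minv_lmon x y : minv (lmon x) (lmon y) = [&& x.2.1, y.2.1 & (y.1 < x.1)%O].
Proof.
rewrite /minv (big_fset_incl _ (finsupp_lmon x)) => [|i _]; last first.
  by rewrite memNfinsupp => /eqP ->; rewrite big1.
rewrite big_seq_fset1 (big_fset_incl _ (finsupp_lmon y)) => [|i _]; last first.
  by rewrite memNfinsupp => /eqP ->; rewrite andbF.
by rewrite big_seq_fset1 !lmonE !eqxx.
Qed.

(** The product of the letters up to sign and vanishing, which are recorded separately by [winv] and
    [wvalid]. *)
Definition wmon u : monomial A := foldr (fun x m => mmul (lmon x) m) [fsfun] u.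

(* No theta occurs twice, i.e., the product of the letters is nonzero. *)
Fixpoint wvalid u : bool :=
  if u is x :: v then ~~ (x.2.1 && (wmon v x.1).1) && wvalid v else true.

Fixpoint winv u : nat :=
  if u is x :: v then (minv (lmon x) (wmon v) + winv v)%N else 0%N.

(* The coefficient of [m] in the product of the letters of [u]; [winv u] counts the
   transpositions that sort the thetas. *)
Definition wcoef u m : rat := ((-1) ^+ winv u) *+ (wvalid u && (wmon u == m)).

Lemma wmon_cat u v : wmon (u ++ v) = mmul (wmon u) (wmon v).
Proof. by elim: u => [|x u IH] /=; rewrite ?mmul0m // IH mmulA. Qed.

Lemma wmonE u i : wmon u i =
  (has (fun x => (x.1 == i) && x.2.1) u, \sum_(x <- u | x.1 == i) x.2.2)%N.
Proof.
elim: u => [|x u IH] /=; first by rewrite fsfun0E big_nil.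
rewrite mmulE IH big_cons lmonE eq_sym /=; case: eqP => //=.
Qed.

Lemma wvalid_cons x u : wvalid (x :: u) <-> mcompat (lmon x) (wmon u) /\ wvalid u.
Proof. by split=> [/andP[/mcompat_lmon]|[/mcompat_lmon /= -> ->]]. Qed.

Lemma wvalid_cat u v :
  wvalid (u ++ v) <-> [/\ wvalid u, wvalid v & mcompat (wmon u) (wmon v)].
Proof.
elim: u => [|x u IH].
  by split=> [vv|[]] //; split => //; exact: mcompat0m.
rewrite cat_cons wvalid_cons IH wmon_cat; split.
  move=> [/mcompatC /mcompatMl [xu xv] [vu vv uv]]; split=> //.
    by apply/wvalid_cons; split=> //; exact: mcompatC.
  by apply/mcompatMl; split=> //; exact: mcompatC.
move=> [/wvalid_cons [xu vu] vv /mcompatMl [xv uv]]; split=> //.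
by apply/mcompatC/mcompatMl; split; exact: mcompatC.
Qed.

Lemma winv_cat u v : wvalid (u ++ v) ->
  winv (u ++ v) = (minv (wmon u) (wmon v) + winv u + winv v)%N.
Proof.
elim: u => [|x u IH]; first by rewrite /= minv0m.
rewrite cat_cons wvalid_cons /= => -[xuv vuv]; rewrite IH // wmon_cat.
have /wvalid_cat[_ _ uv] := vuv.
move: xuv; rewrite wmon_cat => /mcompatC /mcompatMl [/mcompatC xu _].
by rewrite minvMr // minvMl // (addnC (minv _ (wmon u))) addnA addnACA.
Qed.

Lemma wmon_rev u : wmon (rev u) = wmon u.
Proof.
elim: u => [|x u IH] //=.
by rewrite rev_cons -cats1 wmon_cat IH /= mmulm0 mmulC.
Qed.

(** Compatibility is symmetric. Together with [wmon_rev] this allows weakly decreasing words to be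
    read backwards as weakly increasing ones. *)
Lemma wvalid_rev u : wvalid (rev u) = wvalid u.
Proof.
apply: is_true_inj; apply/propext.
elim: u => [|x u IH] //.
rewrite rev_cons -cats1 wvalid_cat (wvalid_cons x u) wmon_rev /= mmulm0 fsfun0E andbF /=.
by split=> [[/IH vu _ /mcompatC]|[/mcompatC xu /IH vu]].
Qed.

Lemma minv_lmon_wmon x u : wvalid u ->
  minv (lmon x) (wmon u) = count (fun y => [&& x.2.1, y.2.1 & (y.1 < x.1)%O]) u.
Proof.
elim: u => [|y u IH]; first by rewrite minvm0.
by rewrite wvalid_cons /= => -[yu vu]; rewrite minvMr // minv_lmon IH.
Qed.

Definition splits m : set (monomial A * monomial A) :=
  [set p | mcompat p.1 p.2 /\ mmul p.1 p.2 = m].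

(** The product of two words is their concatenation: only the splitting [(wmon u, wmon v)] can
    contribute, and its sign is the one found in [winv_cat]. *)
Lemma wcoef_cat u v m :
  \sum_(p \in splits m) ((-1) ^+ minv p.1 p.2 * wcoef u p.1 * wcoef v p.2 : rat) =
  wcoef (u ++ v) m.
Proof.
have term (p : monomial A * monomial A) : (-1) ^+ minv p.1 p.2 * wcoef u p.1 * wcoef v p.2 != 0 ->
    [/\ wvalid u, wvalid v & p = (wmon u, wmon v)].
  rewrite /wcoef; case: (wvalid u); last by rewrite mulr0 mul0r eqxx.
  case: (wvalid v); last by rewrite mulr0 eqxx.
  case: p => p q /=; have [->|] := eqVneq (wmon u) p; last by rewrite mulr0 mul0r eqxx.
  by have [->|] := eqVneq (wmon v) q; last by rewrite mulr0 eqxx.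
rewrite [RHS]/wcoef; have [/andP[vuv /eqP uvm]|nuv] := boolP (_ && _).
  have /wvalid_cat[vu vv uv] := vuv.
  rewrite -(@fsbig_widen _ _ _ _ [set (wmon u, wmon v)]) /=.
  - by rewrite fsbig_set1 /= /wcoef !eqxx vu vv /= -!exprD winv_cat.
  - by move=> _ ->; split=> //=; rewrite -wmon_cat.
  - by move=> p [_]; apply: contra_notP => /eqP /term [_ _].
rewrite mulr0n fsbig1 // => p [pc pm].
apply: contraNeq nuv => /term [vu vv pE].
move: pc pm; rewrite pE /= => uv uvm.
have /wvalid_cat -> : [/\ wvalid u, wvalid v & mcompat (wmon u) (wmon v)] by [].
by rewrite wmon_cat uvm eqxx.
Qed.

(** Both factors in a splitting of [m] are supported in [finsupp m]. It is therefore enough to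
    expand [f] and [g] into words at such monomials, which finitely many words achieve although the
    series are infinite. *)
Lemma smul_words (f g : series A) (I J : Type) (U : seq I) (V : seq J)
    (a : I -> rat) (b : J -> rat) (wu : I -> seq letter) (wv : J -> seq letter) m :
    (forall p, finsupp p `<=` finsupp m -> f p = \sum_(i <- U) a i * wcoef (wu i) p) ->
    (forall p, finsupp p `<=` finsupp m -> g p = \sum_(j <- V) b j * wcoef (wv j) p) ->
  smul f g m = \sum_(i <- U) \sum_(j <- V) a i * b j * wcoef (wu i ++ wv j) m.
Proof.
move=> fE gE; have fin : finite_set (splits m) := finite_splits m.
under [RHS]eq_bigr => i _ do under eq_bigr => j _ do
  rewrite -wcoef_cat (fsbig_finite _ _ fin) mulr_sumr.
under [RHS]eq_bigr do rewrite exchange_big.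
rewrite [RHS]exchange_big /smul (fsbig_finite _ _ fin) /=; apply: eq_big_seq => p.
rewrite in_fset_set // inE => -[_ pm].
rewrite fE ?gE -?pm ?finsupp_mmul ?fsubsetUl ?fsubsetUr //.
rewrite -mulrA mulr_suml mulr_sumr; apply: eq_bigr => i _.
rewrite !mulr_sumr; apply: eq_bigr => j _.
rewrite [RHS]mulrC -!mulrA; congr *%R.
by rewrite mulrCA; congr *%R; rewrite mulrA mulrC.
Qed.

(** * Words with strictly or weakly monotone indices *)

Lemma wmon_out u i : i \notin unzip1 u -> wmon u i = (false, 0%N).
Proof.
elim: u => [|x u IH] /=; first by rewrite fsfun0E.
rewrite inE negb_or => /andP[ix iu].
by rewrite mmulE IH // lmonE (negbTE ix).
Qed.

Lemma mem_finsupp_wmon u : (false, 0%N) \notin unzip2 u ->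
  finsupp (wmon u) =i unzip1 u.
Proof.
elim: u => [_ i|x u IH]; first by rewrite finsupp0 in_fset0.
rewrite inE negb_or => /andP[x0 /IH uE] i /=.
rewrite finsupp_mmul in_fsetU inE uE; congr orb.
rewrite mem_finsupp lmonE; have [_|_] := eqVneq i x.1; last by rewrite eqxx.
by rewrite eq_sym x0.
Qed.

Lemma map_wmon u : uniq (unzip1 u) -> map (wmon u) (unzip1 u) = unzip2 u.
Proof.
elim: u => [|x u IH] //= /andP[xu uu]; rewrite mmulE wmon_out // lmonE eqxx /= orbF addn0.
congr cons; first by case: x.2.
rewrite -IH //; apply/eq_in_map => i iu; rewrite mmulE lmonE.
case: eqP => [ix|_ /=]; last by case: (wmon u i).
by rewrite -ix iu in xu.
Qed.

Lemma sort_finsupp_wmon u : (false, 0%N) \notin unzip2 u ->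
  sorted <%O (unzip1 u) -> sort <=%O (finsupp (wmon u)) = unzip1 u.
Proof.
rewrite lt_sorted_uniq_le => u0 /andP[uu us].
apply: le_sorted_eq => //; first exact: sort_le_sorted.
rewrite perm_sort; apply: uniq_perm (fset_uniq _) uu _; exact: mem_finsupp_wmon.
Qed.

Lemma mtype_wmon u : (false, 0%N) \notin unzip2 u ->
  sorted <%O (unzip1 u) -> mtype (wmon u) = unzip2 u.
Proof.
move=> u0 us; rewrite /mtype sort_finsupp_wmon // map_wmon //.
by move: us; rewrite lt_sorted_uniq_le => /andP[].
Qed.

Lemma wmon_mtype m : wmon (zip (sort <=%O (finsupp m)) (mtype m)) = m.
Proof.
rewrite /mtype; set r := sort _ _.
have ru : uniq r by rewrite sort_uniq fset_uniq.
have -> : zip r [seq m i | i <- r] = [seq (i, m i) | i <- r].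
  by elim: {ru}r => //= i r ->.
apply/fsfunP => i.
have [ir|ir] := boolP (i \in r); last first.
  rewrite wmon_out; last by rewrite /unzip1 -map_comp map_id.
  by move: ir; rewrite mem_sort memNfinsupp => /eqP ->.
elim: r ru ir => //= j r IH /andP[jr ru]; rewrite inE mmulE lmonE /=.
have [-> _|/= ij ir] := eqVneq i j; last by rewrite IH //; case: (m i).
rewrite wmon_out; last by rewrite /unzip1 -map_comp map_id.
by rewrite /= orbF addn0; case: (m j).
Qed.

Lemma wvalid_strict u : uniq (unzip1 u) -> wvalid u.
Proof.
by elim: u => //= x u IH /andP[xu uu]; rewrite wmon_out // andbF IH.
Qed.

Lemma winv_strict u : sorted <%O (unzip1 u) -> winv u = 0%N.
Proof.
elim: u => //= x u IH; rewrite (path_sortedE lt_trans) => /andP[xu us].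
have uu : uniq (unzip1 u) by move: us; rewrite lt_sorted_uniq_le => /andP[].
rewrite IH // addn0 minv_lmon_wmon ?wvalid_strict //.
apply/eqP; rewrite -leqn0 leqNgt -has_count; apply/hasPn => y yu /=.
have /lt_geF : (x.1 < y.1)%O by apply: (allP xu); apply: map_f.
by move=> yx; rewrite lt_neqAle yx !andbF.
Qed.

Lemma wcoef_strict u m : sorted <%O (unzip1 u) -> wcoef u m = (wmon u == m)%:R.
Proof.
move=> us; rewrite /wcoef winv_strict // wvalid_strict //.
by move: us; rewrite lt_sorted_uniq_le => /andP[].
Qed.

(* Every theta is to the left of all the thetas that have a smaller index. *)
Lemma winv_weak u : sorted >=%O (unzip1 u) -> wvalid u ->
  winv u = 'C(count fst (unzip2 u), 2).
Proof.
elim: u => //= x u IH; rewrite (path_sortedE ge_trans) => /andP[xu us] /andP[xv uv].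
rewrite IH // minv_lmon_wmon //; case x2: x.2.1; last by rewrite count_pred0.
(* Pascal's rule: a dotted letter in front is inverted with each of the dotted letters behind it. *)
rewrite binS bin1 addnC; congr addn; rewrite count_map; apply: eq_in_count => y yu /=.
case y2: y.2.1 => //=; rewrite lt_neqAle andbC.
have -> /= : (y.1 <= x.1)%O by apply: (allP xu); apply: map_f.
(* Validity excludes a second theta with the same index, so the weak inequality is strict. *)
move: xv; rewrite x2 wmonE /= => /hasPn /(_ y yu); rewrite y2 andbT => /negbTE ->.
by [].
Qed.

(** The first index of a weakly increasing word is the least index of its monomial, hence is
    determined by it. The first letter is then cancelled and the argument repeated. *)
Lemma weak_word_inj (s : seq (bool * nat)) (v w : seq A) :
    (false, 0%N) \notin s -> size v = size s -> size w = size s ->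
    sorted <=%O v -> sorted <=%O w ->
    wvalid (zip v s) -> wvalid (zip w s) -> wmon (zip v s) = wmon (zip w s) ->
  v = w.
Proof.
elim: s v w => [|p s IH] [|i v] [|j w] //.
move=> s0 [sv] [sw] iv jw vv vw vwE.
(* As no letter of [s] is trivial, every index of a word lies in the support of its monomial. So [k]
   occurs in the other word, whose least index is [l]. *)
have le (k l : A) (v' w' : seq A) : size v' = size s -> size w' = size s ->
    sorted <=%O (l :: w') ->
    wmon (zip (k :: v') (p :: s)) = wmon (zip (l :: w') (p :: s)) -> (l <= k)%O.
  move=> sv' sw' lw kl.
  have kw : k \in l :: w'.
    rewrite -(@unzip1_zip _ _ (l :: w') (p :: s)) /= ?sw' //.
    rewrite -[_ :: _]/(unzip1 (zip (l :: w') (p :: s))).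
    rewrite -mem_finsupp_wmon ?unzip2_zip /= ?sw' //.
    move: kl => /= <-.
    by rewrite (@mem_finsupp_wmon (zip (k :: v') (p :: s))) ?unzip2_zip /= ?inE ?eqxx ?sv'.
  move: kw; rewrite inE => /predU1P[->//|kw].
  by move: lw; rewrite /= (path_sortedE le_trans) => /andP[/allP/(_ _ kw)].
have ij : i = j.
  by apply/le_anti; rewrite (le _ _ _ _ sw sv iv (esym vwE)) (le _ _ _ _ sv sw jw vwE).
move: s0; rewrite inE negb_or => /andP[_ s0].
move: vv vw vwE => /= /andP[vi vv] /andP[vj vw] vwE.
congr cons => //; apply: IH => //; first exact: path_sorted iv.
  exact: path_sorted jw.
apply/fsfunP => k; have /fsfunP/(_ k) := vwE.
rewrite !mmulE !lmonE -ij /=; case: eqP => [->|_ /=]; last first.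
  by case: (wmon _ k) => a b; case: (wmon _ k).
(* At the index [i] the exponents cancel by subtraction. The thetas agree because a dotted [p]
   forces both tails to have none there. *)
move: vi vj; rewrite -ij /=; case: (wmon _ i) => a b; case: (wmon _ i) => a' b'.
by case: p.1 a a' => [] [] [] //= _ _ [/addnI ->].
Qed.

(** * Merging equal indices and the order on dotted compositions *)

Lemma lmon_merge i (p q : bool * nat) :
  mmul (lmon (i, p)) (lmon (i, q)) = lmon (i, (p.1 || q.1, p.2 + q.2)%N).
Proof. by apply/fsfunP => k; rewrite mmulE !lmonE /=; case: eqP. Qed.

Lemma wmon_merge u v i (p q : bool * nat) :
  wmon (u ++ [:: (i, p), (i, q) & v]) =
  wmon (u ++ (i, (p.1 || q.1, p.2 + q.2)%N) :: v).
Proof. by rewrite !wmon_cat /= -lmon_merge -(mmulA (lmon _)). Qed.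

Lemma wvalid_merge u v i (p q : bool * nat) :
  wvalid (u ++ [:: (i, p), (i, q) & v]) <->
  ~~ (p.1 && q.1) /\ wvalid (u ++ (i, (p.1 || q.1, p.2 + q.2)%N) :: v).
Proof.
have cpq : mcompat (lmon (i, p)) (lmon (i, q)) <-> ~~ (p.1 && q.1).
  by rewrite mcompat_lmon lmonE eqxx.
have mE := wmon_merge [::] v i p q; rewrite /= in mE.
split=> [/wvalid_cat[vu /wvalid_cons[c1 /wvalid_cons[c2 vv]] c3]|].
  have /mcompatMl[/mcompatC/cpq pq /mcompatC cp] := mcompatC c1; split=> //.
  apply/wvalid_cat; split=> //; last by rewrite /= -mE.
  apply/wvalid_cons; split=> //.
  by rewrite -lmon_merge; apply/mcompatMl.
move=> [/cpq pq /wvalid_cat[vu /wvalid_cons[]]]; rewrite -lmon_merge.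
move=> /mcompatMl[cp cq] vv c3; apply/wvalid_cat; split=> //; last by rewrite /= mE.
apply/wvalid_cons; split; last exact/wvalid_cons.
by apply/mcompatC/mcompatMl; split; exact: mcompatC.
Qed.

(** An addition of two parts is undone by repeating the index of the merged part. The word stays
    valid since a cover never adds two dotted parts. *)
Lemma dle_word (beta gamma : dcomp) (v : seq A) : dle beta gamma ->
    size v = size gamma -> sorted <=%O v -> wvalid (zip v (map val gamma)) ->
  exists w, [/\ size w = size beta, sorted <=%O w, wvalid (zip w (map val beta)) &
    wmon (zip w (map val beta)) = wmon (zip v (map val gamma))].
Proof.
move=> bg; elim: bg v => {beta gamma} [_ _ [s t p q pq]|beta|a b c _ IHa _ IHb] v.
- move=> sv vs vv.
  (* The index [i] stands at the position of the merged part. *)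
  have [v1 [i [v2 [vE sv1 sv2]]]] : exists (v1 : seq A) i (v2 : seq A),
      [/\ v = v1 ++ i :: v2, size v1 = size s & size v2 = size t].
    move: sv; rewrite size_cat /= => sv; exists (take (size s) v).
    case E: (drop (size s) v) => [|i v2].
      by have := size_drop (size s) v; rewrite E sv /= addKn.
    exists i, v2; rewrite -E cat_take_drop size_takel ?sv ?leq_addr //.
    have := size_drop (size s) v; rewrite E sv /= addKn => -[->].
    by [].
  exists (v1 ++ [:: i, i & v2]); move: vs vv; rewrite vE !map_cat.
  rewrite !zip_cat ?size_map // wmon_merge !size_cat.
  move=> vs vv; split; rewrite /= ?sv1 ?sv2 //; last exact/wvalid_merge.
  move: vs.
  rewrite !le_sorted_pairwise !pairwise_cat !allrel_consr /=.
  by case/and3P=> /andP[-> ->] -> /andP[-> ->]; rewrite lexx.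
- by move=> *; exists v.
- move=> sv vs vv; have [w [sw ws wv <-]] := IHb v sv vs vv; exact: IHa.
Qed.

Lemma sorted_le_ltP (v : seq A) : sorted <=%O v ->
  sorted <%O v \/ exists (v1 : seq A) i (v2 : seq A), v = v1 ++ [:: i, i & v2].
Proof.
elim: v => [|i v IH]; first by left.
move=> iv; have [] := IH (path_sorted iv); last first.
  by move=> [v1 [j [v2 ->]]]; right; exists (i :: v1), j, v2.
case: v iv {IH} => [|j v] /=; first by left.
rewrite le_eqVlt => /andP[/predU1P[-> _ _|-> _ ->]]; last by left.
by right; exists [::], j, v.
Qed.

Lemma dpart_neq0 (beta : dcomp) : (false, 0%N) \notin map val beta.
Proof. by apply/mapP => -[p _ pE]; have := valP p; rewrite -pE. Qed.

(** Merging two adjacent equal indices is a covering step, since validity excludes two dotted parts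
    there. Each merge shortens the word, so induction on the length ends at a strictly increasing
    word, whose composition is the type of the monomial. *)
Lemma word_dle (beta : dcomp) (v : seq A) :
    size v = size beta -> sorted <=%O v -> wvalid (zip v (map val beta)) ->
  exists2 gamma, dle beta gamma & mtype (wmon (zip v (map val beta))) = map val gamma.
Proof.
have [n] := ubnP (size beta); elim: n => // n IH in beta v *.
move=> bn sv /[dup] vs /sorted_le_ltP[vlt vv|[v1 [i [v2 vE]]]].
  exists beta; first exact: rt_refl.
  by rewrite mtype_wmon ?unzip1_zip ?unzip2_zip ?size_map ?sv // dpart_neq0.
have [s [p [q [t [bE sv1 sv2]]]]] : exists (s : dcomp) (p q : dpart) (t : dcomp),
    [/\ beta = s ++ [:: p, q & t], size v1 = size s & size v2 = size t].
  move: sv; rewrite vE size_cat /= => sv; exists (take (size v1) beta).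
  have := size_drop (size v1) beta; rewrite -sv addKn.
  case E: (drop (size v1) beta) => [|p [|q t]] //= [st].
  by exists p, q, t; rewrite -E cat_take_drop size_takel -?sv ?leq_addr.
move: bn vs; rewrite vE bE !map_cat !zip_cat ?size_map // => bn vs.
move=> /wvalid_merge[pq vv]; rewrite wmon_merge.
have [||||gamma bg gE] := IH (s ++ dpart_add p q :: t) (v1 ++ i :: v2).
- by move: bn; rewrite !size_cat /= addnS ltnS.
- by rewrite !size_cat /= sv1 sv2.
- move: vs; rewrite !le_sorted_pairwise !pairwise_cat !allrel_consr /=.
  by case/and3P=> /and3P[-> _ ->] -> /and3P[_ -> ->].
- by rewrite map_cat zip_cat ?size_map.
exists gamma; first by apply: rt_trans bg; apply: rt_step; constructor.
by rewrite -gE map_cat zip_cat ?size_map.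
Qed.

(** * Summation over words of indices *)

Fixpoint words (r : seq A) (k : nat) : seq (seq A) :=
  if k is l.+1 then [seq i :: w | i <- r, w <- words r l] else [:: [::]].

Lemma mem_words (r : seq A) k w :
  (w \in words r k) = (size w == k) && all (mem r) w.
Proof.
elim: k w => [|k IH] w /=; first by rewrite inE; case: w.
apply/allpairsP/idP => [[[i v] /= [ir]]|].
  by rewrite IH => /andP[/eqP <- vr] ->; rewrite eqxx /= vr andbT.
case: w => [|i v] //= /andP[vk /andP[ir vr]].
by exists (i, v); split=> //=; rewrite IH vr andbT.
Qed.

Lemma uniq_words (r : seq A) k : uniq r -> uniq (words r k).
Proof.
move=> ru; elim: k => [//|k IH] /=; apply: allpairs_uniq => //.
by move=> [i v] [j w] _ _ /= [-> ->].
Qed.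

Lemma sum_words_cat (r : seq A) j k (F : seq A -> rat) :
  \sum_(w <- words r (j + k)) F w =
  \sum_(u <- words r j) \sum_(v <- words r k) F (u ++ v).
Proof.
elim: j F => [|j IH] F; first by rewrite big_seq1.
rewrite /= !big_allpairs_dep; apply: eq_bigr => i _.
by rewrite (IH (fun w => F (i :: w))).
Qed.

Lemma unzip1_word (beta : dcomp) (v : seq A) : size v = size beta ->
  unzip1 (zip v (map val beta)) = v.
Proof. by move=> sv; rewrite unzip1_zip // size_map sv. Qed.

Lemma unzip2_word (beta : dcomp) (v : seq A) : size v = size beta ->
  unzip2 (zip v (map val beta)) = map val beta.
Proof. by move=> sv; rewrite unzip2_zip // size_map sv. Qed.

(** The only strictly increasing word that can give [m] is its sorted support. The finite alphabet
    [r] can be any list containing that support, so one [r] can serve for all factors of a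
    monomial. *)
Lemma Mseries_words (beta : dcomp) (m : monomial A) (r : seq A) :
    uniq r -> {subset finsupp m <= r} ->
  Mseries beta m =
  \sum_(w <- words r (size beta))
    (sorted <%O w)%:R * wcoef (zip w (map val beta)) m.
Proof.
move=> ru mr; transitivity (\sum_(w <- words r (size beta))
    (sorted <%O w && (wmon (zip w (map val beta)) == m))%:R : rat); last first.
  apply: eq_big_seq => w; rewrite mem_words => /andP[/eqP sw _].
  have [sw1|] := boolP (sorted <%O w); last by rewrite mul0r.
  by rewrite mul1r wcoef_strict // unzip1_word.
rewrite sum_unique ?uniq_words //; last first.
  move=> v w; rewrite !mem_words => /andP[/eqP sv _] /andP[/eqP sw _].
  move=> /andP[vs /eqP vm] /andP[ws /eqP wm].
  have sortE (x : seq A) : size x = size beta -> sorted <%O x ->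
      sort <=%O (finsupp (wmon (zip x (map val beta)))) = x.
    move=> sx xs; rewrite sort_finsupp_wmon ?unzip1_word //.
    by rewrite unzip2_word // dpart_neq0.
  by rewrite -(sortE v) // -(sortE w) // vm wm.
congr (_%:R); congr nat_of_bool; apply/eqP/hasP => [mE|[w]].
  exists (sort <=%O (finsupp m)); last first.
    by rewrite -mE wmon_mtype eqxx andbT lt_sorted_uniq_le sort_uniq fset_uniq sort_le_sorted.
  rewrite mem_words -(size_map val) -mE size_map eqxx /=.
  by apply/allP => i; rewrite mem_sort => /mr.
rewrite mem_words => /andP[/eqP sw _] /andP[ws /eqP <-].
by rewrite mtype_wmon ?unzip1_word ?unzip2_word ?dpart_neq0.
Qed.

(* The sum of [Mseries gamma] over all [gamma] above [rev beta], see [sum_M_dle]. *)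
Definition Fseries (beta : dcomp) : series A := fun m =>
  (`[< exists2 gamma, dle (rev beta) gamma & mtype m = map val gamma >])%:R.

(** By [winv_weak] all valid weakly decreasing words carry the same sign. Read backwards, at most
    one of them gives [m] by [weak_word_inj], and [dle_word] and [word_dle] show that one exists
    exactly when the type of [m] lies above [rev beta]. *)
Lemma Fseries_words (beta : dcomp) (m : monomial A) (r : seq A) :
    uniq r -> {subset finsupp m <= r} ->
  (-1) ^+ 'C(fdeg beta, 2) * Fseries beta m =
  \sum_(w <- words r (size beta))
    (sorted >=%O w)%:R * wcoef (zip w (map val beta)) m.
Proof.
move=> ru mr.
pose P w := [&& sorted >=%O w, wvalid (zip w (map val beta)) &
  wmon (zip w (map val beta)) == m].
have revP w : size w = size beta -> P w <->
    [/\ sorted <=%O (rev w), wvalid (zip (rev w) (map val (rev beta))) &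
     wmon (zip (rev w) (map val (rev beta))) = m].
  move=> sw; rewrite map_rev -rev_zip ?size_map // wmon_rev wvalid_rev rev_sorted.
  by split=> [/and3P[-> -> /eqP]|[ws wv /eqP wm]] //; exact/and3P.
transitivity (\sum_(w <- words r (size beta)) (-1) ^+ 'C(fdeg beta, 2) * (P w)%:R : rat);
  last first.
  apply: eq_big_seq => w; rewrite mem_words => /andP[/eqP sw _].
  rewrite /P /wcoef; have [ws /=|] := boolP (sorted >=%O w); last by rewrite mulr0 mul0r.
  have [wv /=|] := boolP (wvalid _); last by rewrite mulr0 mulr0.
  rewrite mul1r mulr_natr winv_weak ?unzip1_word ?unzip2_word // count_map.
  by [].
rewrite -mulr_sumr sum_unique ?uniq_words //; last first.
  move=> v w; rewrite !mem_words => /andP[/eqP sv _] /andP[/eqP sw _].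
  move=> /(revP v sv)[vs vv vm] /(revP w sw)[ws wv wm].
  apply: (can_inj revK); apply: (weak_word_inj _ _ _ vs ws vv wv).
  - exact: dpart_neq0.
  - by rewrite size_map !size_rev.
  - by rewrite size_map !size_rev.
  - by rewrite vm wm.
congr (_ * _%:R); congr nat_of_bool; apply/asboolP/hasP => [[gamma bg mE]|[w]].
  (* [m] is the word of [gamma] along its sorted support, which is valid because the indices are
     distinct. [dle_word] spreads it into a word of [rev beta], to be reversed. *)
  have mr0 : wmon (zip (sort <=%O (finsupp m)) (map val gamma)) = m.
    by rewrite -mE wmon_mtype.
  have [|||w [sw ws wv wm]] := @dle_word _ _ (sort <=%O (finsupp m)) bg.
  - by rewrite -(size_map val gamma) -mE size_map.
  - exact: sort_le_sorted.
  - apply: wvalid_strict; rewrite unzip1_zip ?sort_uniq ?fset_uniq //.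
    by rewrite -mE size_map.
  exists (rev w); last by apply/revP; rewrite ?revK ?size_rev ?sw ?size_rev ?wm.
  rewrite mem_words size_rev sw size_rev eqxx /= all_rev.
  apply/allP => i iw; apply: mr; rewrite -mr0 -wm mem_finsupp_wmon.
    by rewrite unzip1_word.
  by rewrite unzip2_word // dpart_neq0.
rewrite mem_words => /andP[/eqP sw _] /(revP w sw)[ws wv <-].
by apply: word_dle => //; rewrite !size_rev.
Qed.

Lemma alternating_sum_sorted (w : seq A) :
  \sum_(k < (size w).+1)
    (-1) ^+ k * (sorted >=%O (take k w))%:R * (sorted <%O (drop k w))%:R =
  (w == [::])%:R :> rat.
Proof.
elim: w => [|i w IH]; first by rewrite big_ord1 !mulr1.
case: w IH => [|j w] IH; first by rewrite !big_ord_recl big_ord0 /= !mulr1 addr0 addrN.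
(* Let X be the indicator that [j :: w] is strictly increasing. The terms k = 0 and k = 1 are
   [i < j] X and -X. By induction the terms k >= 2 add up to [j <= i] X, so everything cancels. *)
rewrite big_ord_recl /= !mul1r big_ord_recl /= mulr1 mulN1r.
move: IH; rewrite big_ord_recl /= !mul1r => /eqP; rewrite addr_eq0 => /eqP IH.
under eq_bigr => k _.
  rewrite exprS mulN1r -mulnb natrM (mulrCA _ (j <= i)%O%:R) mulNr.
  by rewrite -mulrA mulNr; over.
rewrite -mulr_sumr sumrN -IH.
have [ij|ij] := ltP i j; first by rewrite mul0r addr0 addrN.
by rewrite mul1r add0r addNr.
Qed.
End Monomials.

(** * The antipode *)

(** The claimed values of the antipode satisfy the left antipode identity on the basis. This is the
    recursion against which [antipode_M] compares S. *)
Lemma antipode_convolution (alpha : dcomp) :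
  \sum_(k < (size alpha).+1)
    smul ((-1) ^+ (k + 'C(fdeg (take k alpha), 2)) *: Fseries (take k alpha))
      (Mseries (drop k alpha)) = (alpha == [::])%:R *: sone nat.
Proof.
apply/funext => m; rewrite fct_sumE.
pose r : seq nat := finsupp m; have ru : uniq r by exact: fset_uniq.
pose s k (w : seq nat) : rat :=
  (-1) ^+ k * (sorted >=%O (take k w))%:R * (sorted <%O (drop k w))%:R.
(* For each k a word for all of [alpha] is cut after k letters: the prefix comes from [Fseries] and
   the suffix from [Mseries]. Exchanging the sums then isolates the alternating sum over the cuts of
   one word. *)
transitivity (\sum_(k < (size alpha).+1) \sum_(w <- words r (size alpha))
    s k w * wcoef (zip w (map val alpha)) m : rat).
  apply: eq_bigr => k _; have ka : (k <= size alpha)%N by rewrite -ltnS.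
  rewrite (smul_words (U := words r k) (V := words r (size alpha - k))
    (a := fun u => (-1) ^+ k * (sorted >=%O u)%:R)
    (b := fun v => (sorted <%O v)%:R)
    (wu := fun u => zip u (map val (take k alpha)))
    (wv := fun v => zip v (map val (drop k alpha)))) => [|p pm|p pm].
  - have -> : words r (size alpha) = words r (k + (size alpha - k)) by rewrite subnKC.
    rewrite sum_words_cat; apply: eq_big_seq => u.
    rewrite mem_words => /andP[/eqP uk _]; apply: eq_bigr => v _.
    rewrite /s take_size_cat // drop_size_cat // -zip_cat ?size_map ?size_takel //.
    by rewrite -map_cat cat_take_drop.
  - have := Fseries_words (take k alpha) ru (fsubsetP pm).
    rewrite size_takel // => FE.
    rewrite -[LHS]/((-1) ^+ _ * Fseries _ _) exprD -mulrA FE.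
    by rewrite mulr_sumr; apply: eq_bigr => u _; rewrite mulrA.
  - by rewrite (Mseries_words _ ru (fsubsetP pm)) size_drop.
rewrite exchange_big /=.
under eq_big_seq => w.
  rewrite mem_words => /andP[/eqP wk _].
  rewrite -mulr_suml -wk alternating_sum_sorted; over.
rewrite fctE; case: alpha {s} => [|p alpha].
  by rewrite big_seq1 mul1r /wcoef /= scale1r /sone eq_sym.
rewrite scale0r big_seq big1 // => w.
by rewrite mem_words; case: w => //= i w _; rewrite mul0r.
Qed.

Lemma Mseries_nil d (A : orderType d) : Mseries [::] = sone A.
Proof.
apply/funext => m; rewrite /Mseries /sone; congr (_%:R); congr nat_of_bool.
apply/eqP/eqP => [m0|->]; last by rewrite /mtype finsupp0.
by rewrite -[LHS]wmon_mtype m0; case: sort.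
Qed.

(** In the left antipode identity the last term of the coproduct gives S(M_alpha) times 1, and all
    other terms involve S on shorter prefixes. By strong induction these agree with the terms of
    [antipode_convolution] and cancel. *)
Lemma antipode_M (S : {linear sQSym -> sQSym}) (hS : is_antipode S) (alpha : dcomp) :
  sqval (S (M alpha)) =
  (-1) ^+ (size alpha + 'C(fdeg alpha, 2)) *: Fseries alpha.
Proof.
have [n] := ubnP (size alpha); elim: n => // n IH in alpha * => an.
have [+ _] := hS _ _ _ _ (coproduct_M alpha).
rewrite counit_M -antipode_convolution !big_ord_recr /=.
rewrite take_size drop_size Mseries_nil !smulr1.
have eqS k : (k < size alpha)%N ->
    sqval (S (M (take k alpha))) =
    (-1) ^+ (k + 'C(fdeg (take k alpha), 2)) *: Fseries (take k alpha).
  by move=> ka; rewrite IH size_takel ?(ltnW ka) //; apply: leq_trans ka _.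
have -> : \sum_(k < size alpha)
      smul (S (M (take k alpha))) (Mseries (drop k alpha)) =
    \sum_(k < size alpha)
      smul ((-1) ^+ (k + 'C(fdeg (take k alpha), 2)) *: Fseries (take k alpha))
        (Mseries (drop k alpha)) :> series nat.
  by apply: eq_bigr => k _; rewrite eqS.
by move=> /addrI.
Qed.

(** A monomial has a single type, and [val] is injective on parts, so at most one [gamma]
    contributes to its coefficient. *)
Lemma sum_M_dle (beta : dcomp) (m : monomial nat) :
  sqval (\sum_(gamma \in [set gamma : dcomp | dle beta gamma]) M gamma) m =
  Fseries (rev beta) m.
Proof.
rewrite fsbig_finite; last exact: finite_dle.
rewrite -[sqval _]/(val (_ : sQSym)) raddf_sum fct_sumE.
rewrite (sum_unique (P := fun gamma : dcomp => mtype m == map val gamma)) ?fset_uniq //.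
- rewrite /Fseries revK; congr (_%:R); congr nat_of_bool.
  apply/hasP/asboolP => [[gamma]|[gamma bg /eqP mE]].
    by rewrite in_fset_set ?inE; [move=> bg /eqP mE; exists gamma|exact: finite_dle].
  by exists gamma; rewrite // in_fset_set ?inE //; exact: finite_dle.
- move=> x y _ _ /eqP -> /eqP; apply: inj_map; exact: val_inj.
Qed.

Theorem proposition5p10 (S : {linear sQSym -> sQSym}) (hS : is_antipode S)
    (alpha : dcomp) :
  S (M alpha) =
    (-1) ^+ (size alpha + 'C(fdeg alpha, 2)) *:
      \sum_(gamma \in [set gamma : dcomp | dle (rev alpha) gamma]) M gamma.
Proof.
apply: val_inj; rewrite [RHS]linearZ -[LHS]/(sqval _) antipode_M //.
congr (_ *: _); apply/funext => m.
by rewrite -[RHS]/(sqval _ m) sum_M_dle revK.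
Qed.
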